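(* For $m\ge 3$ and $n\ge 5m-2$, $\sigma(C_{2m+2},n)=m(2n-m-1)+4$.
   Context: A sequence $S=(d_1,\dots,d_n)$ of non-negative integers is graphical if there is a simple graph on $n$ vertices $v_1,\dots,v_n$ with $d(v_i)=d_i$; such a graph is a realization of $S$. $S$ is potentially $H$-graphical if some realization of $S$ contains $H$ as a subgraph. $\sigma(S)=d_1+\cdots+d_n$. For a graph $H$, $\sigma(H,n)$ is the smallest even integer $l$ such that every $n$-term graphical sequence $S$ with $\sigma(S)\ge l$ is potentially $H$-graphical. $C_k$ denotes the cycle on $k$ vertices. *)

(* Defs.v *)
From mathcomp Require Import all_boot.

Set Implicit Arguments.
Unset Strict Implicit.
Unset Printing Implicit Defensive.

Record sgraph (V : finType) := SGraph {
  adj : rel V;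
  adj_sym : symmetric adj;
  adj_irrefl : irreflexive adj
}.

Definition degree (V : finType) (G : sgraph V) (v : V) : nat :=
  #|[set u | adj G v u]|.

(* "G contains H as a subgraph": not necessarily induced. *)
Definition contains_subgraph (V W : finType) (G : sgraph V) (H : sgraph W) :
  Prop :=
  exists f : W -> V,
    injective f /\ forall x y : W, adj H x y -> adj G (f x) (f y).

Section CycleGraph.

Variable k : nat.

(* The conjunct [i != j] only matters for k = 1, where it removes the loop. *)
Definition cycle_adj : rel 'I_k := fun i j =>
  (i != j) && ((i.+1 %% k == j) || (j.+1 %% k == i)).

Lemma cycle_adj_sym : symmetric cycle_adj.
Proof. by move=> i j; rewrite /cycle_adj eq_sym orbC. Qed.

Lemma cycle_adj_irrefl : irreflexive cycle_adj.
Proof. by move=> i; rewrite /cycle_adj eqxx. Qed.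

Definition cycle_graph : sgraph 'I_k := SGraph cycle_adj_sym cycle_adj_irrefl.

End CycleGraph.

Definition realization (n : nat) (S : n.-tuple nat) (G : sgraph 'I_n) : Prop :=
  forall i : 'I_n, degree G i = tnth S i.

Definition graphical (n : nat) (S : n.-tuple nat) : Prop :=
  exists G : sgraph 'I_n, realization S G.

Definition potentially_graphical (W : finType) (H : sgraph W) (n : nat)
    (S : n.-tuple nat) : Prop :=
  exists G : sgraph 'I_n, realization S G /\ contains_subgraph G H.

Definition forces_potentially (W : finType) (H : sgraph W) (n l : nat) : Prop :=
  forall S : n.-tuple nat,
    graphical S -> l <= sumn S -> potentially_graphical H S.

(* [is_sigma H n l] says sigma(H, n) = l.  Some even l always qualifies, since
   the degree sum of an n-vertex simple graph is at most n * n.-1. *)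
Definition is_sigma (W : finType) (H : sgraph W) (n l : nat) : Prop :=
  [/\ ~~ odd l,
      forces_potentially H n l
    & forall l' : nat, ~~ odd l' -> forces_potentially H n l' -> l <= l'].

(* Main.v *)
Require Import Defs.
From mathcomp Require Import all_boot zify.
From Stdlib Require Import Classical.

(* Upper bound: among all realizations of the degree sequence, take one with a
   longest possible cycle [s].  Since edge switchings never give a longer cycle,
   a vertex [u] off the cycle has no two consecutive neighbours on [s], the
   successors of its neighbours are pairwise non-adjacent, and [u] has at most
   one neighbour off the cycle; if it has one, then its neighbours on [s] are at
   distance at least three.  If [size s <= 2 m + 1], counting edges then bounds
   the degree sum strictly below the threshold.  A switching also turns a cycle
   of length [k + 1] into one of length [k] in another realization, so the long
   cycle can be shortened to length exactly [2 m + 2].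

   Lower bound: [K_m] joined to one edge and [n - m - 2] isolated vertices is
   the only realization of its degree sequence, and a cycle of length [2 m + 2]
   would need two edges avoiding the [m] hubs. *)

Set Implicit Arguments.
Unset Strict Implicit.
Unset Printing Implicit Defensive.

(** * Degree-preserving switchings *)

Section Switching.

Variable V : finType.
Implicit Types (G : sgraph V) (s : seq V).

Definition is_edge (a b x y : V) : bool :=
  ((x == a) && (y == b)) || ((x == b) && (y == a)).

Lemma is_edge_sym a b : symmetric (is_edge a b).
Proof.
by move=> x y; rewrite /is_edge orbC [(y == b) && _]andbC [(y == a) && _]andbC.
Qed.

Lemma toggle_sym G a b :
  symmetric (fun x y => adj G x y (+) ((a != b) && is_edge a b x y)).
Proof. by move=> x y; rewrite adj_sym is_edge_sym. Qed.

Lemma toggle_irrefl G a b :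
  irreflexive (fun x y => adj G x y (+) ((a != b) && is_edge a b x y)).
Proof.
move=> x; rewrite adj_irrefl /= /is_edge [(x == b) && _]andbC orbb.
by have [<-|] := eqVneq x a; rewrite ?andbF //; case: eqP.
Qed.

(** Flipping one pair at a time lets degrees be tracked edge by edge through a switching. The guard
    [a != b] keeps the relation irreflexive: toggling [a] with itself changes nothing. *)
Definition toggle G a b : sgraph V :=
  SGraph (toggle_sym G a b) (toggle_irrefl G a b).

Lemma adjE_neq G x y : adj G x y -> x != y.
Proof. by apply: contraTneq => ->; rewrite adj_irrefl. Qed.

Lemma toggle_degree_del G a b x : adj G a b ->
  degree (toggle G a b) x + ((x == a) + (x == b)) = degree G x.
Proof.
move=> ab; have nab := adjE_neq ab; rewrite /degree.
have [->|xa] := eqVneq x a.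
  rewrite (negbTE nab) addn0 [RHS](cardsD1 b) inE ab addnC; congr (_ + _).
  apply: eq_card => y; rewrite !inE /= /is_edge nab eqxx (negbTE nab) /= orbF.
  by case: (eqVneq y b) => [->|_]; rewrite ?ab ?addbF.
have [->|xb] := eqVneq x b.
  rewrite add0n [RHS](cardsD1 a) inE adj_sym ab addnC; congr (_ + _).
  apply: eq_card => y; rewrite !inE /= /is_edge nab eqxx eq_sym (negbTE nab) /=.
  by case: (eqVneq y a) => [->|_]; rewrite ?(adj_sym G b) ?ab ?addbF.
rewrite !addn0; apply: eq_card => y.
by rewrite !inE /= /is_edge (negbTE xa) (negbTE xb) andbF addbF.
Qed.

(** Toggling is an involution, so adding an edge is the deletion count read backwards. *)
Lemma toggle_degree_add G a b x : a != b -> ~~ adj G a b ->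
  degree (toggle G a b) x = degree G x + ((x == a) + (x == b)).
Proof.
move=> nab nadj.
have ab' : adj (toggle G a b) a b by rewrite /= nab /is_edge !eqxx (negbTE nadj).
rewrite -(toggle_degree_del x ab'); congr (_ + _).
by apply: eq_card => y; rewrite !inE /= -addbA addbb addbF.
Qed.

Definition same_degrees G G' := forall v, degree G' v = degree G v.

(** The alternating 4-cycle trades [ab], [cd] for [ac], [bd]; each of the four vertices loses one
    edge and gains one. The last clause says that every other edge survives. *)
Lemma switch4 G a b c d :
    adj G a b -> adj G c d -> a != c -> b != d ->
    ~~ adj G a c -> ~~ adj G b d ->
  exists G', [/\ same_degrees G G', adj G' a c, adj G' b d
    & forall x y, adj G x y -> ~~ is_edge a b x y -> ~~ is_edge c d x y ->
        adj G' x y].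
Proof.
move=> ab cd ac bd nac nbd.
have nab := adjE_neq ab; have ncd := adjE_neq cd.
have nbc : b != c by apply: contraNneq nac => <-.
have nad : a != d by apply: contraNneq nac => ->; rewrite adj_sym.
have [ba [dc [ca [db [cb da]]]]] : b != a /\ d != c /\ c != a /\ d != b /\ c != b /\ d != a.
  by do !split; rewrite eq_sym.
pose G1 := toggle G a b; pose G2 := toggle G1 c d.
pose G3 := toggle G2 a c; pose G4 := toggle G3 b d.
have E := (negbTE nab, negbTE ncd, negbTE nbc, negbTE nad, negbTE ac, negbTE bd,
  negbTE ba, negbTE dc, negbTE ca, negbTE db, negbTE cb, negbTE da).
have h1 : adj G1 c d by rewrite /= /is_edge !E /= ?andbF ?addbF.
have h2 : ~~ adj G2 a c by rewrite /= /is_edge ?eqxx !E /= ?andbF ?addbF.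
have h3 : ~~ adj G3 b d by rewrite /= /is_edge ?eqxx !E /= ?andbF ?addbF.
exists G4; split.
- move=> v; rewrite (toggle_degree_add v bd h3) (toggle_degree_add v ac h2).
  rewrite -(toggle_degree_del v ab) -(toggle_degree_del v h1).
  rewrite -/G2; move: (degree G2 v) => k; clear.
  by move: (v == a) (v == b) (v == c) (v == d) => *; lia.
- by rewrite /= /is_edge ?eqxx !E /= ?andbF ?addbF (negbTE nac).
- by rewrite /= /is_edge ?eqxx !E /= ?andbF ?addbF (negbTE nbd).
move=> x y xy nxy1 nxy2.
have -> : adj G4 x y = adj G x y; last by [].
rewrite /= (negbTE nxy1) (negbTE nxy2) !andbF !addbF.
have -> : is_edge a c x y = false.
  by apply: contraTF xy => /orP[]/andP[/eqP-> /eqP->]; rewrite ?(adj_sym G c).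
have -> : is_edge b d x y = false.
  by apply: contraTF xy => /orP[]/andP[/eqP-> /eqP->]; rewrite ?(adj_sym G d).
by rewrite !andbF !addbF.
Qed.

(* The six vertices need not be distinct: the alternating closed trail
   [a b c d e f] may revisit a vertex. *)
Lemma switch6 G a b c d e f :
    [/\ adj G a b, adj G c d & adj G e f] ->
    [/\ ~~ adj G b c, ~~ adj G d e & ~~ adj G f a] ->
    [/\ b != c, d != e & f != a] ->
    [/\ ~~ is_edge a b c d, ~~ is_edge a b e f & ~~ is_edge c d e f] ->
    [/\ ~~ is_edge b c d e, ~~ is_edge b c f a & ~~ is_edge d e f a] ->
  exists G', [/\ same_degrees G G',
    [/\ adj G' b c, adj G' d e & adj G' f a]
    & forall x y, adj G x y -> ~~ is_edge a b x y -> ~~ is_edge c d x y ->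
        ~~ is_edge e f x y -> adj G' x y].
Proof.
move=> [ab cd ef] [bc de fa] [nbc nde nfa] [e1 e2 e3] [n1 n2 n3].
(* An edge and a non-edge are never the same pair, so deletions and additions do not interfere. *)
have K x y p q : adj G x y -> ~~ adj G p q -> is_edge x y p q = false.
  by move=> h; apply: contraNF => /orP[]/andP[/eqP-> /eqP->]; rewrite // adj_sym.
have K' x y p q : adj G x y -> ~~ adj G p q -> is_edge p q x y = false.
  by move=> h; apply: contraNF => /orP[]/andP[/eqP<- /eqP<-]; rewrite // adj_sym.
have R x y : is_edge x y x y by rewrite /is_edge !eqxx.
have S p q x y : ~~ is_edge p q x y -> ~~ is_edge x y p q.
  by rewrite /is_edge ![p == _]eq_sym ![q == _]eq_sym [(y == p) && _]andbC.
pose G1 := toggle G a b; pose G2 := toggle G1 c d; pose G3 := toggle G2 e f.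
pose G4 := toggle G3 b c; pose G5 := toggle G4 d e; pose G6 := toggle G5 f a.
have h1 : adj G1 c d by rewrite /= (negbTE e1) andbF addbF.
have h2 : adj G2 e f by rewrite /= (negbTE e2) (negbTE e3) !andbF !addbF.
have h3 : ~~ adj G3 b c by rewrite /= !K // !andbF !addbF.
have h4 : ~~ adj G4 d e.
  by rewrite /= (K a b) // (K c d) // (K e f) // (negbTE n1) !andbF !addbF.
have h5 : ~~ adj G5 f a.
  rewrite /= (K a b) // (K c d) // (K e f) // (negbTE n2) (negbTE n3).
  by rewrite !andbF !addbF.
exists G6; split.
- move=> v; rewrite (toggle_degree_add v nfa h5) (toggle_degree_add v nde h4).
  rewrite (toggle_degree_add v nbc h3).
  rewrite -(toggle_degree_del v ab) -(toggle_degree_del v h1).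
  rewrite -(toggle_degree_del v h2) -/G3; move: (degree G3 v) => k; clear.
  by move: (v == a) (v == b) (v == c) (v == d) (v == e) (v == f) => *; lia.
- split; rewrite /= (K a b) // (K c d) // (K e f) //.
  + by rewrite nbc R (negbTE bc) (negbTE (S _ _ _ _ n1)) (negbTE (S _ _ _ _ n2)) !andbF.
  + by rewrite (negbTE n1) nde R (negbTE de) (negbTE (S _ _ _ _ n3)) !andbF.
  + by rewrite (negbTE n2) (negbTE n3) nfa R (negbTE fa) !andbF.
move=> x y xy nx1 nx2 nx3; rewrite /= (negbTE nx1) (negbTE nx2) (negbTE nx3).
by rewrite !K' // !andbF !addbF.
Qed.

End Switching.

(** * Switchings around a longest cycle *)

(** Shows that two pairs differ as edges, from the vertex inequalities in the context. *)
Ltac edge_neq :=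
  rewrite /is_edge ?negb_or ?negb_and;
  repeat match goal with H : is_true (?a != ?b) |- _ =>
    rewrite ?(eq_sym b a) ?H; clear H end;
  rewrite ?orbT ?andbT //.

Section LongestCycle.

Variable V : finType.
Implicit Types (G : sgraph V) (s p : seq V).

(** Maximality ranges over all realizations of the degrees of [G], which is what makes switchings
    usable. The bound [2 < size s] excludes a single edge walked back and forth, which [cycle]
    accepts. *)
Definition longest_cycle G s :=
  [/\ 2 < size s, uniq s, cycle (adj G) s
    & forall G' s', same_degrees G G' -> uniq s' -> cycle (adj G') s' ->
        size s' <= size s].

Lemma longest_cycle_rot G s k : longest_cycle G s -> longest_cycle G (rot k s).
Proof. by case=> *; split; rewrite ?size_rot ?rot_uniq ?rot_cycle. Qed.

Lemma cycle_rev G s : cycle (adj G) (rev s) = cycle (adj G) s.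
Proof. by rewrite rev_cycle; apply: eq_cycle => x y; rewrite adj_sym. Qed.

Lemma longest_cycle_rev G s : longest_cycle G s -> longest_cycle G (rev s).
Proof. by case=> *; split; rewrite ?size_rev ?rev_uniq ?cycle_rev. Qed.

(** Rotating the cycle to start at [x] transfers facts about an explicit list [[:: x, y, z & p]] to
    [next]. *)
Lemma longest_cycle_at G s x : longest_cycle G s -> x \in s ->
  exists2 p, longest_cycle G [:: x, next s x, next s (next s x) & p]
    & [:: x, next s x, next s (next s x) & p] =i s.
Proof.
move=> lc xs; have [s3 us _ _] := lc.
have [k q e] := rot_to xs; have lcr := longest_cycle_rot k lc.
have nx y : next s y = next (x :: q) y by rewrite -e next_rot.
have q2 : 1 < size q by have := size_rot k s; rewrite e /= => sE; rewrite -sE in s3.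
have uq : uniq (x :: q) by rewrite -e rot_uniq.
case: q => [//|y [//|z p]] in e nx q2 uq *.
have yx : y == x = false by move: uq; rewrite /= !inE eq_sym; case: eqP.
have e1 : next s x = y by rewrite nx /= eqxx.
have e2 : next s y = z by rewrite nx /= yx eqxx.
exists p; rewrite e1 e2 -e //; exact: mem_rot.
Qed.

Lemma path_keep G G' s z q :
    (forall a b, adj G a b -> a \notin s -> b \notin s -> adj G' a b) ->
    all (fun t => t \notin s) (z :: q) -> path (adj G) z q ->
  path (adj G') z q.
Proof.
move=> h; apply: (@sub_in_path _ [pred t | t \notin s]) => a b /=.
by rewrite !inE => as_ bs_ ab; apply: h.
Qed.

Lemma crossing_cycle_uniq (p1 p2 : seq V) (a b u : V) :
  uniq (u :: a :: p1 ++ b :: p2) -> uniq (p1 ++ [:: b, u, a & rev p2]).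
Proof.
apply: etrans; apply: perm_uniq; apply/permP => f.
by rewrite /= !count_cat /= count_rev; lia.
Qed.

(** * Three consecutive vertices of a longest cycle *)

Section Consecutive.

Variables (G : sgraph V) (x y z : V) (p : seq V).
Notation s := [:: x, y, z & p].
Hypothesis lc : longest_cycle G s.

Lemma lc_edges : [/\ adj G x y, adj G y z & path (adj G) z (rcons p x)].
Proof. by case: lc => _ _ /= /and3P[]. Qed.

Lemma lc_neq : [/\ x != y, x != z & y != z].
Proof.
case: lc => _ + _ _; rewrite /= !inE !negb_or.
by case/and4P=> /and3P[xy xz _] /andP[yz _] _ _; split.
Qed.

Lemma lc_notin : [/\ x \notin p, y \notin p & z \notin p].
Proof.
case: lc => _ + _ _; rewrite /= !inE !negb_or.
by case/and4P=> /and3P[_ _ ?] /andP[_ ?] ? _; split.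
Qed.

Lemma lc_max G' s' : same_degrees G G' -> uniq s' -> cycle (adj G') s' ->
  size s < size s' -> False.
Proof. by case: lc => _ _ _ h d u c; have := h G' s' d u c; rewrite leqNgt => /negP. Qed.

Lemma lc_out u : u \notin s -> [/\ u != x, u != y, u != z & u \notin p].
Proof. by rewrite !inE !negb_or => /and4P[]. Qed.

(** Every edge removed by the switchings below meets [u] or [y], so the stretch of the cycle from
    [z] round to [x] survives them. *)
Lemma lc_rest u : u \notin s -> all (fun t => t \notin [:: u; y]) (z :: rcons p x).
Proof.
move=> /lc_out[ux uy uz up]; have [xy xz yz] := lc_neq; have [xp yp zp] := lc_notin.
rewrite /= !inE !negb_or eq_sym uz eq_sym yz /= all_rcons !inE !negb_or.
rewrite eq_sym ux xy /=; apply/allP => t tp; rewrite !inE negb_or.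
by apply/andP; split; apply: contraTneq tp => ->.
Qed.

Lemma lc_uniq_insert u : u \notin s -> uniq [:: x, u, y, z & p].
Proof.
move=> us; have : uniq (u :: s) by rewrite /= us; case: lc => _ /= ->.
by apply: etrans; apply: perm_uniq; apply/permP => a /=; rewrite addnCA.
Qed.

(** Otherwise [u] could be inserted between [x] and [y]. *)
Lemma no_consecutive_nbrs u : u \notin s -> adj G u x -> ~~ adj G u y.
Proof.
move=> us ux; apply/negP => uy; have [xy yz pz] := lc_edges.
apply: (@lc_max G [:: x, u, y, z & p]) => //; first exact: lc_uniq_insert.
by rewrite /= adj_sym ux uy yz.
Qed.

(** If [v] and [t] were non-adjacent, trading [uv], [yt] for [uy], [vt] would let [u] be inserted
    between [x] and [y]. The conditions [v != x] and [t != z] protect the edges [ux] and [yz] of the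
    new cycle. *)
Lemma nbr_switch u v t : u \notin s -> adj G u x -> adj G u v -> v != x ->
  adj G y t -> t != z -> v != t -> adj G v t.
Proof.
move=> us ux uv vx yt tz vt; apply: contraT => nvt.
have nuy := no_consecutive_nbrs us ux.
have [ux' uy uz up] := lc_out us; have [xy xz yz] := lc_neq.
have [exy eyz pz] := lc_edges.
have nyt := adjE_neq yt; have nuv := adjE_neq uv.
have [G' [dG' uy' _ keep]] := switch4 uv yt uy vt nuy nvt.
exfalso; apply: (@lc_max G' [:: x, u, y, z & p]) => //; first exact: lc_uniq_insert.
rewrite /= uy' /=; apply/and3P; split.
- by apply: keep; rewrite 1?adj_sym //; edge_neq.
- by apply: keep => //; edge_neq.
apply: path_keep (lc_rest us) pz => a b ab; rewrite !inE !negb_or.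
by move=> /andP[au ay] /andP[bu by_]; apply: keep => //; edge_neq.
Qed.

Lemma nbrs_sub u v : u \notin s -> adj G u x -> adj G u v -> v != x -> adj G v x.
Proof.
move=> us ux uv vx; have [_ xz _] := lc_neq; have [xy _ _] := lc_edges.
by apply: (nbr_switch us ux uv vx _ xz vx); rewrite adj_sym.
Qed.

(** The closed trail [x y u v w u], visiting [u] twice, trades [xy], [uv], [wu] for [yu], [vw],
    [ux]; then [u] fits between [x] and [y]. *)
Lemma nbrs_clique u v w : u \notin s -> ~~ adj G u x -> ~~ adj G u y ->
  adj G u v -> adj G u w -> v != w -> adj G v w.
Proof.
move=> us nux nuy uv uw vw; apply: contraT => nvw.
have [ux uy uz up] := lc_out us; have [xy xz yz] := lc_neq.
have [exy eyz pz] := lc_edges.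
have nuv := adjE_neq uv; have nuw := adjE_neq uw.
have vx : v != x by apply: contraNneq nux => <-.
have vy : v != y by apply: contraNneq nuy => <-.
have wx : w != x by apply: contraNneq nux => <-.
have wy : w != y by apply: contraNneq nuy => <-.
have [|||||G' [dG' [yu' _ ux'] keep]] := @switch6 _ G x y u v w u.
- by split; rewrite // adj_sym.
- by split; rewrite // adj_sym.
- by split; rewrite // eq_sym.
- by split; edge_neq.
- by split; edge_neq.
exfalso; apply: (@lc_max G' [:: x, u, y, z & p]) => //; first exact: lc_uniq_insert.
rewrite /= adj_sym ux' adj_sym yu' /=; apply/andP; split.
  by apply: keep; edge_neq.
apply: path_keep (lc_rest us) pz => a b ab; rewrite !inE !negb_or.
by move=> /andP[au ay] /andP[bu by_]; apply: keep => //; edge_neq.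
Qed.

(** Otherwise trading [uv], [xy] for [ux], [vy] would route the cycle through [x u w v y]. *)
Lemma triangle_cross u v w : u \notin s -> v \notin s -> w \notin s ->
  adj G u v -> adj G v w -> adj G w u -> ~~ adj G u x -> adj G v y.
Proof.
move=> us vs ws uv vw wu nux; apply: contraT => nvy.
have [ux uy uz up] := lc_out us; have [vx vy vz vp] := lc_out vs.
have [wx wy wz wp] := lc_out ws.
have [xy xz yz] := lc_neq; have [exy eyz pz] := lc_edges.
have nuv := adjE_neq uv; have nvw := adjE_neq vw; have nwu := adjE_neq wu.
have [G' [dG' ux' vy' keep]] := switch4 uv exy ux vy nux nvy.
exfalso; apply: (@lc_max G' [:: x, u, w, v, y, z & p]) => //; last exact: leqW (leqW (leqnn _)).
  have : uniq [:: w, v & [:: x, u, y, z & p]].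
    rewrite cons_uniq [uniq (_ :: _)]cons_uniq lc_uniq_insert // !inE !negb_or.
    by rewrite vp wp; edge_neq.
  by rewrite (perm_uniq (permEl (perm_catCA [:: w; v] [:: x; u] _))).
rewrite /= adj_sym ux' vy' /=; apply/and4P; split.
- by apply: keep; rewrite 1?adj_sym //; edge_neq.
- by apply: keep; rewrite 1?adj_sym //; edge_neq.
- by apply: keep => //; edge_neq.
apply: path_keep (lc_rest us) pz => a b ab; rewrite !inE !negb_or.
by move=> /andP[au ay] /andP[bu by_]; apply: keep => //; edge_neq.
Qed.

(** Otherwise [u], [v] could replace [y] on the cycle. *)
Lemma no_detour u v : u \notin s -> v \notin s ->
  adj G u v -> adj G u x -> ~~ adj G v z.
Proof.
move=> us vs uv ux; apply/negP => vz; have [xy yz pz] := lc_edges.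
apply: (@lc_max G [:: x, u, v, z & p]) => //; last first.
  by rewrite /= adj_sym ux uv vz.
have [_ _ _ up] := lc_out us; have [vx _ nvz vp] := lc_out vs.
have [xp yp zp] := lc_notin; have nuv := adjE_neq uv.
have [_ xz _] := lc_neq; have [nux _ nuz _] := lc_out us.
have : uniq s by case: lc.
rewrite /= !inE !negb_or => /and4P[_ _ _ ->].
by rewrite xp up vp zp; edge_neq.
Qed.

End Consecutive.

End LongestCycle.

(** * Structure of the graph off a longest cycle *)

Section CycleComplement.

Variables (V : finType) (G : sgraph V) (s : seq V).
Hypothesis lc : longest_cycle G s.
Notation nx := (next s).

Lemma lc_nbr_next u x : u \notin s -> x \in s -> adj G u x -> ~~ adj G u (nx x).
Proof.
move=> us xs; have [p lcp sE] := longest_cycle_at lc xs.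
by apply: (no_consecutive_nbrs lcp); rewrite sE.
Qed.

Lemma lc_nbrs_sub u v x : u \notin s -> x \in s -> adj G u x -> adj G u v ->
  v != x -> adj G v x.
Proof.
move=> us xs; have [p lcp sE] := longest_cycle_at lc xs.
by apply: (nbrs_sub lcp); rewrite sE.
Qed.

Lemma lc_nbrs_clique u v w x : u \notin s -> x \in s -> ~~ adj G u x ->
  ~~ adj G u (nx x) -> adj G u v -> adj G u w -> v != w -> adj G v w.
Proof.
move=> us xs; have [p lcp sE] := longest_cycle_at lc xs.
by apply: (nbrs_clique lcp); rewrite sE.
Qed.

Lemma lc_no_detour u v x : u \notin s -> v \notin s -> x \in s -> adj G u v ->
  adj G u x -> ~~ adj G v (nx (nx x)).
Proof.
move=> us vs xs; have [p lcp sE] := longest_cycle_at lc xs.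
by apply: (no_detour lcp); rewrite sE.
Qed.

Lemma lc_triangle_cross u v w x : u \notin s -> v \notin s -> w \notin s ->
  x \in s -> adj G u v -> adj G v w -> adj G w u -> ~~ adj G u x ->
  adj G v (nx x).
Proof.
move=> us vs ws xs; have [p lcp sE] := longest_cycle_at lc xs.
by apply: (triangle_cross lcp); rewrite sE.
Qed.

Lemma out_cycle_neq u x : u \notin s -> x \in s -> u != x.
Proof. by move=> us; apply: contraTneq => <-. Qed.

Lemma no_triangle_off_cycle u v w : u \notin s -> v \notin s -> w \notin s ->
  adj G u v -> adj G v w -> adj G w u -> False.
Proof.
(* A neighbour [x] of the triangle on the cycle is already contradictory: [triangle_cross] at the
   successor of [x] yields an edge forbidden by [no_detour]. If [u] has no edge to [x], crossing
   makes [v] adjacent to [nx x], and the triangle is relabelled. *)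
have base u' v' w' x : u' \notin s -> v' \notin s -> w' \notin s ->
    adj G u' v' -> adj G v' w' -> adj G w' u' -> x \in s -> adj G u' x -> False.
  move=> us vs ws uv vw wu xs ux; have nuy := lc_nbr_next us xs ux.
  have xs' : nx x \in s by rewrite mem_next.
  have := lc_triangle_cross us vs ws xs' uv vw wu nuy.
  by apply/negP; apply: lc_no_detour ux.
move=> us vs ws uv vw wu.
have [x xs] : exists x, x \in s.
  by case: lc; case: (s) => // x q *; exists x; rewrite mem_head.
case: (boolP (adj G u x)) => [|nux]; first exact: (base u v w).
have := lc_triangle_cross us vs ws xs uv vw wu nux.
by apply: (base v w u); rewrite ?mem_next.
Qed.

(** Two off-cycle neighbours [v], [w] would be non-adjacent, so by the clique property [u] meets
    every pair of consecutive cycle vertices. It is then adjacent to some [x] and to [nx (nx x)];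
    the latter is also a neighbour of [v], against [no_detour]. *)
Lemma off_cycle_nbr_unique u v w : u \notin s -> v \notin s -> w \notin s ->
  adj G u v -> adj G u w -> v = w.
Proof.
move=> us vs ws uv uw; apply/eqP; apply: contraT => nvw.
have nadj : ~~ adj G v w.
  apply/negP => vw; apply: (no_triangle_off_cycle us vs ws uv vw).
  by rewrite adj_sym.
have hit x : x \in s -> adj G u x || adj G u (nx x).
  move=> xs; apply: contraR nadj; rewrite negb_or => /andP[n1 n2].
  exact: lc_nbrs_clique n1 n2 uv uw nvw.
have [x xs ux] : exists2 x, x \in s & adj G u x.
  have [x xs] : exists x, x \in s.
    by case: lc; case: (s) => // x q *; exists x; rewrite mem_head.
  by case/orP: (hit x xs) => h; [exists x | exists (nx x); rewrite ?mem_next].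
have ys : nx x \in s by rewrite mem_next.
have zs : nx (nx x) \in s by rewrite mem_next.
have uz : adj G u (nx (nx x)).
  by have := hit _ ys; rewrite (negbTE (lc_nbr_next us xs ux)).
have := lc_nbrs_sub us zs uz uv (out_cycle_neq vs zs).
by rewrite (negbTE (lc_no_detour us vs xs uv ux)).
Qed.

Section OffCycleEdge.

Variables u v : V.
Hypotheses (us : u \notin s) (vs : v \notin s) (uv : adj G u v).

Lemma off_edge_common x : x \in s -> adj G u x = adj G v x.
Proof.
move=> xs; have vu : adj G v u by rewrite adj_sym.
apply/idP/idP => h; apply: lc_nbrs_sub h _ _ => //; exact: out_cycle_neq.
Qed.

Lemma off_edge_gap x : x \in s -> adj G u x -> ~~ adj G u (nx (nx x)).
Proof.
move=> xs ux; rewrite off_edge_common ?mem_next //.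
exact: lc_no_detour ux.
Qed.

(** By [nbr_switch], [t] is a neighbour of [v]. Off the cycle it could only be [u], which is not
    adjacent to [nx x]; on the cycle [u] and [v] have the same neighbours. *)
Lemma off_edge_next_nbr x t : x \in s -> adj G u x -> adj G (nx x) t ->
  t != nx (nx x) -> (t \in s) && adj G u t.
Proof.
move=> xs ux yt tz; have ys : nx x \in s by rewrite mem_next.
have nuy := lc_nbr_next us xs ux.
have vt : v != t.
  by apply: contraNneq nuy => e; rewrite off_edge_common // adj_sym e.
have {}vt : adj G v t.
  have [p lcp sE] := longest_cycle_at lc xs.
  by apply: (nbr_switch lcp _ ux uv _ yt tz vt); rewrite ?sE ?out_cycle_neq.
case: (boolP (t \in s)) => [ts|ts]; first by rewrite off_edge_common.
have vu : adj G v u by rewrite adj_sym.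
by case/negP: nuy; rewrite (off_cycle_nbr_unique vs us ts vu vt) adj_sym.
Qed.

End OffCycleEdge.

Lemma lc_nexts_indep u x x' : u \notin s -> x \in s -> x' \in s ->
  adj G u x -> adj G u x' -> ~~ adj G (nx x) (nx x').
Proof.
move=> us xs xs' ux ux'.
have [<-|xx'] := eqVneq x x'; first by rewrite adj_irrefl.
have [_ su _ _] := lc; have [k q e] := rot_to xs.
have x'q : x' \in q.
  by move: xs'; rewrite -(mem_rot k) e inE eq_sym (negbTE xx').
move: e; case/splitPr: q / x'q => q1 q2 e.
have nE t : nx t = next (x :: q1 ++ x' :: q2) t by rewrite -e next_rot.
(* The same cycle read from [x'], so that its successor is the second entry. If [q1] or [q2] is
   empty, [x] and [x'] are consecutive neighbours of [u]. *)
have nE' t : nx t = next ((x' :: q2) ++ x :: q1) t.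
  rewrite -(rot_size_cat (x :: q1)) next_rot -?nE //.
  by rewrite -[_ ++ _]e rot_uniq.
have nxt := lc_nbr_next us xs ux; have nxt' := lc_nbr_next us xs' ux'.
case: q1 => [|y q1] in e nE nE' *.
  by case/negP: nxt; rewrite nE /= eqxx.
case: q2 => [|y' q2] in e nE nE' *.
  by case/negP: nxt'; rewrite nE' /= eqxx.
have -> : nx x = y by rewrite nE /= eqxx.
have -> : nx x' = y' by rewrite nE' /= eqxx.
apply/negP => yy'.
have := longest_cycle_rot k lc; rewrite e => -[_ uq cq mx].
(* Reroute through [u], running backwards from [x] to the successor of [x']. *)
have := mx G ((y :: q1) ++ [:: x', u, x & rev (y' :: q2)]).
rewrite /= !size_cat /= size_rev /= !addnS ltnn.
move=> h; suff : false by []; apply: h => //.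
  apply: (@crossing_cycle_uniq _ (y :: q1) (y' :: q2)).
  by rewrite cons_uniq uq andbT -e mem_rot.
move: cq; rewrite /= !rcons_cat /= !cat_path /= rcons_path /=.
case/and5P=> xy p1 lx' x'y' /andP[p2 lx].
rewrite p1 lx' adj_sym ux' ux /= rcons_path /=.
have := rev_path (adj G) y' (rcons q2 x).
rewrite last_rcons belast_rcons => ->.
rewrite (eq_path (e' := adj G)) => [|? ?]; last by rewrite adj_sym.
by rewrite rcons_path p2 lx rev_cons last_rcons adj_sym yy'.
Qed.

Lemma next_imset_card (A : {set V}) : #|[set next s x | x in A]| = #|A|.
Proof.
by have [_ us _ _] := lc; apply: card_imset; apply: can_inj (prev_next us).
Qed.

End CycleComplement.

(** * Counting edges around a longest cycle *)

Lemma sum_le_two_level (V : finType) (B C : {set V}) (f : V -> nat) (k l : nat) :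
    B \subset C -> (forall x, x \in B -> f x <= k) ->
    (forall x, x \in C -> x \notin B -> f x <= l) ->
  \sum_(x in C) f x <= #|B| * k + (#|C| - #|B|) * l.
Proof.
move=> BC fk fl; rewrite (big_setID B) /= (setIidPr BC) -cardsDS //.
rewrite -!sum_nat_const; apply: leq_add; apply: leq_sum => x; first exact: fk.
by rewrite inE => /andP[xB xC]; apply: fl.
Qed.

Section DegreeSum.

Variables (V : finType) (G : sgraph V) (C : {set V}).

Definition nbrs_in (v : V) : {set V} := [set x in C | adj G v x].
Definition nbrs_out (v : V) : {set V} := [set x | adj G v x & x \notin C].

Lemma degree_split v : degree G v = #|nbrs_in v| + #|nbrs_out v|.
Proof.
rewrite /degree -(cardsID C); congr (_ + _); apply: eq_card => x.
  by rewrite !inE andbC.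
by rewrite !inE andbC.
Qed.

(** Edges between [C] and its complement are all charged to their outer end, hence the factor 2. *)
Lemma degree_sum_split : \sum_v degree G v =
  \sum_(v in C) #|nbrs_in v| +
  \sum_(v | v \notin C) (2 * #|nbrs_in v| + #|nbrs_out v|).
Proof.
have cross : \sum_(v in C) #|nbrs_out v| = \sum_(v | v \notin C) #|nbrs_in v|.
  under eq_bigr do rewrite -sum1_card big_mkcond /=.
  rewrite exchange_big /= [RHS]big_mkcond; apply: eq_bigr => u _.
  have [uC|uC] := boolP (u \in C).
    by rewrite big1 // => v _; rewrite inE uC andbF.
  rewrite -sum1_card big_mkcond [RHS]big_mkcond; apply: eq_bigr => v _.
  by rewrite !inE uC andbT adj_sym; case: (v \in C).
rewrite (bigID (mem C)) /=; under eq_bigr do rewrite degree_split.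
rewrite big_split /= cross -addnA; congr (_ + _).
rewrite -big_split /=; apply: eq_bigr => v _; rewrite degree_split.
by rewrite mul2n -addnn addnA.
Qed.

Lemma nbrs_in_lt v : v \in C -> #|nbrs_in v| <= #|C|.-1.
Proof.
move=> vC; rewrite [#|C|](cardsD1 v) vC /=; apply: subset_leq_card.
apply/subsetP => x; rewrite !inE => /andP[-> vx].
by rewrite eq_sym (adjE_neq vx).
Qed.

Lemma nbrs_in_avoid v (D : {set V}) : D \subset C ->
  (forall x, x \in D -> ~~ adj G v x) -> #|nbrs_in v| <= #|C| - #|D|.
Proof.
move=> DC h; rewrite -cardsDS //; apply: subset_leq_card.
apply/subsetP => x; rewrite !inE => /andP[-> vx]; rewrite andbT.
by apply: contraL vx; apply: h.
Qed.

End DegreeSum.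

Section LongestCycleCount.

Variables (V : finType) (G : sgraph V) (s : seq V).
Hypothesis lc : longest_cycle G s.
Notation C := [set x in s].
Notation A := (nbrs_in G C).
Notation nexts u := [set next s x | x in A u].
Notation prevs u := [set prev s x | x in A u].

Lemma card_cycle_set : #|C| = size s.
Proof. by have [_ us _ _] := lc; rewrite cardsE; apply/card_uniqP. Qed.

Lemma nexts_sub u : nexts u \subset C.
Proof. by apply/subsetP => _ /imsetP[x + ->]; rewrite !inE mem_next => /andP[]. Qed.

Lemma prevs_sub u : prevs u \subset C.
Proof. by apply/subsetP => _ /imsetP[x + ->]; rewrite !inE mem_prev => /andP[]. Qed.

Lemma card_nexts u : #|nexts u| = #|A u|.
Proof. exact: (next_imset_card lc). Qed.

Lemma card_prevs u : #|prevs u| = #|A u|.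
Proof.
by have [_ us _ _] := lc; apply: card_imset; apply: can_inj (next_prev us).
Qed.

Lemma nexts_disjoint u : u \notin s -> [disjoint A u & nexts u].
Proof.
move=> us; rewrite disjoint_sym disjoints_subset.
apply/subsetP => _ /imsetP[x + ->]; rewrite !inE mem_next.
by case/andP=> xs ux; rewrite xs (lc_nbr_next lc).
Qed.

Lemma prev_rev x : prev s x = next (rev s) x.
Proof. by have [_ us _ _] := lc; rewrite next_rev. Qed.

Lemma prevs_disjoint u : u \notin s -> [disjoint A u & prevs u].
Proof.
move=> us; rewrite disjoint_sym disjoints_subset.
apply/subsetP => _ /imsetP[x + ->]; rewrite !inE mem_prev.
case/andP=> xs ux; rewrite xs /= prev_rev.
by apply: (lc_nbr_next (longest_cycle_rev lc)); rewrite ?mem_rev.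
Qed.

Lemma nexts_indep u x y : u \notin s -> x \in nexts u -> y \in nexts u ->
  ~~ adj G x y.
Proof.
move=> us /imsetP[x' + ->] /imsetP[y' + ->]; rewrite !inE.
by move=> /andP[? ?] /andP[? ?]; apply: (lc_nexts_indep lc (u := u)).
Qed.

Lemma prevs_indep u x y : u \notin s -> x \in prevs u -> y \in prevs u ->
  ~~ adj G x y.
Proof.
move=> us /imsetP[x' + ->] /imsetP[y' + ->]; rewrite !inE !prev_rev.
move=> /andP[? ?] /andP[? ?].
by apply: (lc_nexts_indep (longest_cycle_rev lc) (u := u)); rewrite ?mem_rev.
Qed.

Lemma card_nbrs_on_cycle u : u \notin s -> 2 * #|A u| <= size s.
Proof.
move=> us; have := (leq_card_setU (A u) (nexts u)).2.
rewrite nexts_disjoint // card_nexts addnn -mul2n => /eqP <-.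
rewrite -card_cycle_set; apply: subset_leq_card; rewrite subUset nexts_sub andbT.
by apply/subsetP => x; rewrite !inE => /andP[].
Qed.

Lemma cycle_sum_nexts u (k : nat) : u \notin s ->
    (forall x, x \in nexts u -> #|A x| <= k) ->
  \sum_(x in C) #|A x| <=
    #|A u| * k + (size s - #|A u|) * (size s).-1.
Proof.
move=> us hk; rewrite -card_cycle_set -(card_nexts u).
by apply: sum_le_two_level => //; [exact: nexts_sub | move=> x xC _; exact: nbrs_in_lt].
Qed.

(** The successors of the neighbours of [u] form an independent set of size [#|A u|], so each of
    them misses that many cycle vertices. *)
Lemma cycle_sum_indep u : u \notin s ->
  \sum_(x in C) #|A x| <=
    #|A u| * (size s - #|A u|) + (size s - #|A u|) * (size s).-1.
Proof.
move=> us; apply: cycle_sum_nexts => // x xn.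
rewrite -card_cycle_set -(card_nexts u); apply: nbrs_in_avoid (nexts_sub u) _.
by move=> y; apply: nexts_indep xn.
Qed.

(** Here successors and predecessors of [A u] together fill its complement [U], of size [a + 1], and
    share a set [I] of size [a - 1]. A vertex of [I] misses all of [U], one more vertex than
    independence of [nexts u] or [prevs u] alone gives; this saves [a - 1]. *)
Lemma cycle_sum_odd u : u \notin s -> size s = (2 * #|A u|).+1 ->
  \sum_(x in C) #|A x| + #|A u|.-1 <=
    #|A u|.+1 * #|A u|.+1 + #|A u| * (2 * #|A u|).
Proof.
move=> us; set a := #|A u| => sE.
set U := nexts u :|: prevs u; set I := nexts u :&: prevs u.
have [lc3 uniqs _ _] := lc.
have UC : U \subset C by rewrite subUset nexts_sub prevs_sub.
have IU : I \subset U by rewrite subIset // subsetUl.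
have AC : A u \subset C by apply/subsetP => x; rewrite !inE => /andP[].
have UI : #|U| + #|I| = a + a by rewrite cardsUI card_nexts card_prevs.
have disj : A u :&: U = set0.
  rewrite setIUr; have := nexts_disjoint us; have := prevs_disjoint us.
  by rewrite -!setI_eq0 => /eqP-> /eqP->; rewrite setU0.
have AUC : A u :|: U \subset C by rewrite subUset AC.
have cAU : #|A u :|: U| = a + #|U| by rewrite cardsU disj cards0 subn0.
have Ule : a + #|U| <= size s.
  by rewrite -cAU -card_cycle_set subset_leq_card.
(* Otherwise [A u] together with its successors would be closed under [next],
   leaving a single vertex that is its own predecessor. *)
have Uge : a < #|U|.
  rewrite ltnNge; apply/negP => Ua.
  have aU : a <= #|U| by rewrite /a -(card_nexts u) subset_leq_card ?subsetUl.
  have nU : nexts u = U.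
    by apply/eqP; rewrite eqEcard subsetUl card_nexts.
  have pU : prevs u = U.
    by apply/eqP; rewrite eqEcard subsetUr card_prevs.
  have closed x : x \in A u :|: U -> next s x \in A u :|: U.
    rewrite !(in_setU _ (A u)) => /orP[xA|].
      by rewrite -nU imset_f ?orbT.
    by rewrite -{1}pU => /imsetP[y yA ->]; rewrite next_prev // yA.
  have [p pC pn] : exists2 p, p \in C & p \notin A u :|: U.
    have [/subset_leq_card|/subsetPn[p pC pn]] := boolP (C \subset A u :|: U).
      by rewrite cAU card_cycle_set sE; move: Ua; clear; lia.
    by exists p.
  have closedC : C :\: (A u :|: U) = [set p].
    apply/esym/eqP; rewrite eqEcard sub1set inE pn pC cards1.
    by rewrite cardsDS // cAU card_cycle_set sE /=; move: Ua aU; clear; lia.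
  have : prev s p \in C :\: (A u :|: U).
    rewrite in_setD; apply/andP; split.
      by apply: contra pn => /closed; rewrite next_prev.
    by move: pC; rewrite !inE mem_prev.
  rewrite closedC in_set1 => /eqP pp.
  have ps : p \in s by move: pC; rewrite inE.
  have [q lcq _] := longest_cycle_at lc ps.
  have [/negP[]] := lc_neq lcq.
  by rewrite -{2}pp next_prev.
have Ia : #|I| = a.-1 by move: UI Uge Ule; rewrite sE; clear; lia.
have Ua : #|U| = a.+1 by move: UI Uge Ule; rewrite sE; clear; lia.
have IC : I \subset C by apply: subset_trans UC.
(* The indicator of [I] absorbs the saving, leaving the uniform bound [a + 1] on [U]. *)
have -> : \sum_(x in C) #|A x| + a.-1 = \sum_(x in C) (#|A x| + (x \in I)).
  rewrite big_split /= -Ia; congr (_ + _).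
  rewrite -sum1_card [RHS](big_setID I) /= (setIidPr IC) [X in _ + X]big1 ?addn0.
    by apply: eq_bigr => x ->.
  by move=> x; rewrite in_setD => /andP[/negbTE->].
have := @sum_le_two_level V U C (fun x => #|A x| + (x \in I)) a.+1 (2 * a) UC.
rewrite Ua card_cycle_set sE (_ : (2 * a).+1 - a.+1 = a); last by clear; lia.
apply => [x xU|x xC xU]; last first.
  rewrite (contraNF (subsetP IU x) xU) addn0.
  by have := nbrs_in_lt G xC; rewrite card_cycle_set sE.
have [xI|xI] := boolP (x \in I).
  rewrite addn1 ltnS; move: xI; rewrite inE => /andP[xn xp].
  rewrite (_ : a = #|C| - #|U|); last by rewrite card_cycle_set Ua sE; clear; lia.
  apply: nbrs_in_avoid => // y /setUP[]; first exact: nexts_indep xn.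
  exact: prevs_indep xp.
rewrite addn0 (_ : a.+1 = #|C| - a); last by rewrite card_cycle_set sE; clear; lia.
case/setUP: xU => [xn|xp].
  rewrite /a -(card_nexts u); apply: nbrs_in_avoid (nexts_sub u) _ => y.
  exact: nexts_indep xn.
rewrite /a -(card_prevs u); apply: nbrs_in_avoid (prevs_sub u) _ => y.
exact: prevs_indep xp.
Qed.

Lemma card_nbrs_out u : u \notin s -> #|nbrs_out G C u| <= 1.
Proof.
move=> us; apply/card_le1P => v; rewrite !inE => /andP[uv vs] w.
rewrite !inE; apply/idP/eqP => [/andP[uw ws]|->]; last by rewrite uv.
by apply: (off_cycle_nbr_unique lc us).
Qed.

Section OffEdge.

Variables u v : V.
Hypotheses (us : u \notin s) (vs : v \notin s) (uv : adj G u v).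

(** The successor of a neighbour [x] of [u] is adjacent only to [next s (next s x)] and to vertices
    of [A u]. *)
Lemma cycle_sum_off_edge :
  \sum_(x in C) #|A x| <=
    #|A u| * #|A u|.+1 + (size s - #|A u|) * (size s).-1.
Proof.
apply: cycle_sum_nexts => // _ /imsetP[x + ->]; rewrite inE => /andP[xs ux].
rewrite inE in xs.
apply: (@leq_trans #|next s (next s x) |: A u|); last first.
  by rewrite cardsU1; case: (_ \notin _); rewrite ?leqnSn.
apply: subset_leq_card; apply/subsetP => t; rewrite !inE => /andP[ts yt].
have [//|tz /=] := eqVneq t (next s (next s x)).
exact: (off_edge_next_nbr lc us vs uv xs ux yt tz).
Qed.

(** [A u] and its first and second shifts along the cycle are pairwise disjoint. *)
Lemma card_nbrs_off_edge : 3 * #|A u| <= size s.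
Proof.
pose A2 := [set next s x | x in nexts u].
have c2 : #|A2| = #|A u| by rewrite (next_imset_card lc) card_nexts.
have inj : injective (next s).
  by have [_ us' _ _] := lc; apply: can_inj (prev_next us').
have d1 : A u :&: nexts u = set0 by apply/eqP; rewrite setI_eq0 nexts_disjoint.
have d2 : nexts u :&: A2 = set0.
  by rewrite -imsetI ?d1 ?imset0 // => x y _ _; apply: inj.
have d3 : A u :&: A2 = set0.
  apply/setP => y; rewrite !inE; apply/negP => /andP[/andP[_ uy]].
  case/imsetP=> _ /imsetP[x + ->] yE; rewrite !inE => /andP[xs ux].
  by case/negP: (off_edge_gap lc us vs uv xs ux); rewrite -yE.
have : #|A u :|: nexts u :|: A2| <= size s.
  rewrite -card_cycle_set; apply: subset_leq_card; rewrite !subUset nexts_sub.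
  apply/andP; split.
    by rewrite andbT; apply/subsetP => x; rewrite !inE => /andP[].
  by apply/subsetP => _ /imsetP[x /(subsetP (nexts_sub u)) + ->];
    rewrite !inE mem_next.
rewrite cardsU setIUl d2 d3 setU0 cards0 subn0 cardsU d1 cards0 subn0.
by rewrite card_nexts c2; clear; lia.
Qed.

End OffEdge.

(** Here [a] is the largest number of cycle neighbours of an off-cycle vertex. The second
    alternative arises when some vertex attaining [a] also has an off-cycle neighbour. *)
Lemma longest_cycle_degree_sum : size s < #|V| ->
  let c := size s in exists2 a, 2 * a <= c &
  (\sum_v degree G v <=
     a * (c - a) + (c - a) * c.-1 + (#|V| - c) * (2 * a) /\
   (c = (2 * a).+1 -> \sum_v degree G v + a.-1 <=
     a.+1 * a.+1 + a * (2 * a) + (#|V| - c) * (2 * a)))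
  \/ (3 * a <= c /\
   \sum_v degree G v <=
     a * a.+1 + (c - a) * c.-1 + (#|V| - c) * (2 * a).+1).
Proof.
move=> cV c.
have cN : #|[pred v | v \notin C]| = #|V| - c.
  by rewrite -(cardsC C) card_cycle_set addKn; apply: eq_card => v; rewrite !inE.
have [u0 u0s] : exists u, u \notin s.
  have : 0 < #|[pred v | v \notin C]| by rewrite cN subn_gt0.
  by case/card_gt0P=> u; rewrite !inE => h; exists u.
case: (@arg_maxnP _ u0 (fun u => u \notin s) (fun u => #|A u|) u0s) => u us umax.
exists #|A u|; first exact: card_nbrs_on_cycle.
rewrite (degree_sum_split G C).
have bnd b : (forall v, v \notin s -> 2 * #|A v| + #|nbrs_out G C v| <= b) ->
    \sum_(v | v \notin C) (2 * #|A v| + #|nbrs_out G C v|) <= (#|V| - c) * b.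
  by move=> h; rewrite -cN -sum_nat_const; apply: leq_sum => v; rewrite inE; apply: h.
have [/existsP[w /and3P[ws /eqP wA w1]]|no] :=
  boolP [exists w, [&& w \notin s, #|A w| == #|A u| & 0 < #|nbrs_out G C w|]].
  right; have [v] := card_gt0P w1; rewrite !inE => /andP[wv vs].
  rewrite -wA; split; first exact: (card_nbrs_off_edge ws vs wv).
  apply: leq_add; first exact: (cycle_sum_off_edge ws vs wv).
  apply: bnd => t ts; have := umax _ ts; have := card_nbrs_out ts.
  by rewrite -wA; clear; lia.
left.
(* An off-cycle neighbour now forces [#|A v| < #|A u|], which pays for the extra 1. *)
have b2 : forall v, v \notin s -> 2 * #|A v| + #|nbrs_out G C v| <= 2 * #|A u|.
  move=> v vs; have := umax _ vs; have := card_nbrs_out vs.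
  move: no; rewrite negb_exists => /forallP/(_ v); rewrite vs /=.
  by clear; lia.
split=> [|cE].
  by apply: leq_add; [exact: cycle_sum_indep | exact: bnd].
rewrite addnAC; apply: leq_add; [exact: cycle_sum_odd | exact: bnd].
Qed.

End LongestCycleCount.

(** * Finding and shortening cycles *)

Section ShortCycles.

Variable V : finType.
Implicit Types (G : sgraph V) (s : seq V).

Definition potential_cycle G k :=
  exists G' s, [/\ same_degrees G G', uniq s, cycle (adj G') s & size s = k].

Lemma degree_gt1_other_nbr G u v : 1 < degree G v ->
  exists2 y, adj G v y & y != u.
Proof.
rewrite /degree (cardsD1 u) => h.
have : 0 < #|[set w | adj G v w] :\ u| by move: h; case: (u \in _) => [|/ltnW].
by case/card_gt0P=> y; rewrite !inE => /andP[yu vy]; exists y.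
Qed.

(** Let [H] be the vertices of degree at least 2. If each vertex had at most one neighbour in [H],
    it would contribute at most 2 to the split sum. So some [u] has neighbours [v], [w] in [H], with
    further neighbours [y], [z]: either a cycle of length 3, 4 or 5 is present, or trading [vy],
    [wz] for [vw], [yz] makes a triangle. *)
Lemma potential_cycle_start G : 2 * #|V| < \sum_v degree G v ->
  exists2 k, 2 < k & potential_cycle G k.
Proof.
move=> sum_gt; pose H := [set v | 1 < degree G v].
have [/existsP[u /card_gt1P[v [w []]]]|] :=
    boolP [exists u, 1 < #|nbrs_in G H u|]; last first.
  rewrite negb_exists => /forallP small.
  suff : \sum_v degree G v <= 2 * #|V| by rewrite leqNgt sum_gt.
  rewrite (degree_sum_split G H).
  apply: (@leq_trans (#|H| * 2 + (#|V| - #|H|) * 2)); last first.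
    by rewrite -mulnDl subnKC ?max_card // mulnC.
  apply: leq_add.
    rewrite -sum_nat_const; apply: leq_sum => v _.
    by apply: leqW; rewrite leqNgt.
  have -> : #|V| - #|H| = #|[pred v | v \notin H]|.
    by rewrite -(cardsC H) addKn; apply: eq_card => v; rewrite !inE.
  rewrite -sum_nat_const; apply: leq_sum => v.
  by rewrite inE -leqNgt (degree_split G H); lia.
rewrite !inE => /andP[v1 uv] /andP[w1 uw] vw.
have [y vy yu] := degree_gt1_other_nbr u v1.
have [z wz zu] := degree_gt1_other_nbr u w1.
have nuv := adjE_neq uv; have nuw := adjE_neq uw.
have nvy := adjE_neq vy; have nwz := adjE_neq wz.
have vu : adj G v u by rewrite adj_sym.
have wu : adj G w u by rewrite adj_sym.
have yv : adj G y v by rewrite adj_sym.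
have zw : adj G z w by rewrite adj_sym.
have [evw|nevw] := boolP (adj G v w).
  exists 3 => //; exists G, [:: u; v; w]; split=> //.
    by rewrite /= !inE !negb_or; edge_neq.
  by rewrite /= uv evw wu.
have yw : y != w by apply: contraNneq nevw => <-.
have zv : z != v by apply: contraNneq nevw => <-; rewrite adj_sym.
have [yz|nyz] := eqVneq y z.
  exists 4 => //; exists G, [:: u; v; y; w]; split=> //.
    by rewrite /= !inE !negb_or; edge_neq.
  by rewrite /= uv vy yz zw wu.
have [eyz|neyz] := boolP (adj G y z).
  exists 5 => //; exists G, [:: u; v; y; z; w]; split=> //.
    by rewrite /= !inE !negb_or; edge_neq.
  by rewrite /= uv vy eyz zw wu.
have [G' [dG' vw' _ keep]] := switch4 vy wz vw nyz nevw neyz.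
exists 3 => //; exists G', [:: u; v; w]; split=> //.
  by rewrite /= !inE !negb_or; edge_neq.
by rewrite /= vw' !keep //; edge_neq.
Qed.

Lemma rot_next s x : uniq s -> 3 < size s -> x \in s ->
  exists k p, rot k s =
    [:: x, next s x, next s (next s x), next s (next s (next s x)) & p].
Proof.
move=> us s4 xs; have [k q e] := rot_to xs.
have nx y : next s y = next (x :: q) y by rewrite -e next_rot.
have q2 : size s = (size q).+1 by rewrite -(size_rot k s) e.
have uq : uniq (x :: q) by rewrite -e rot_uniq.
case: q => [|y [|z [|h p]]] in e nx q2 uq *; rewrite ?q2 // in s4.
exists k, p; rewrite e.
move: uq; rewrite /= !inE !negb_or -!andbA => /and5P[xy xz xh _ /and4P[yz yh _ _]].
have e1 : next s x = y by rewrite nx /= eqxx.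
have e2 : next s y = z by rewrite nx /= (eq_sym y x) (negbTE xy) eqxx.
have e3 : next s z = h.
  by rewrite nx /= (eq_sym z x) (negbTE xz) (eq_sym z y) (negbTE yz) eqxx.
by rewrite e1 e2 e3.
Qed.

(** * Cycles that no switching shortens by one *)

Section Shorten.

Variables (G : sgraph V) (s : seq V).
Hypotheses (us : uniq s) (cs : cycle (adj G) s) (s4 : 3 < size s).
Hypothesis no_short : ~ potential_cycle G (size s).-1.
Notation nx := (next s).

Lemma cycle_iter_next x y : x \in s -> y \in s -> exists j, iter j nx x = y.
Proof.
move=> xs ys; exists (findex nx x y); apply: iter_findex.
by rewrite (fconnect_cycle (cycle_next us) xs).
Qed.

Lemma cycle_window x : x \in s -> exists p, let y := nx x in let z := nx y in
  let h := nx z in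
  [/\ [:: x, y, z, h & p] =i s, [/\ x != y, x != z & y != z],
      [/\ adj G x y, adj G y z, adj G z h & path (adj G) h (rcons p x)],
      all (fun t => t \notin [:: y; z]) (h :: rcons p x)
    & uniq [:: x, z, h & p] /\ size [:: x, z, h & p] = (size s).-1].
Proof.
move=> xs; have [k [p e]] := rot_next us s4 xs; exists p => y z h.
have uq : uniq [:: x, y, z, h & p] by rewrite -e rot_uniq.
have cq : cycle (adj G) [:: x, y, z, h & p] by rewrite -e rot_cycle.
split.
- by move=> t; rewrite -e mem_rot.
- by move: uq; rewrite /= !inE !negb_or -!andbA; case/and5P=> ? ? _ _ /andP[? _].
- by move: cq; rewrite /= => /and4P[].
- move: uq; rewrite /= all_rcons !inE !negb_or -!andbA.
  case/and5P=> xy xz xh xp /and5P[yz yh yp zh /and3P[zp hp up]].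
  rewrite xy xz (eq_sym h y) yh (eq_sym h z) zh /=.
  apply/allP => t tp; rewrite !inE negb_or.
  by apply/andP; split; apply: contraTneq tp => ->.
- have -> : size s = size (rot k s) by rewrite size_rot.
  rewrite e; split=> //; move: uq.
  rewrite (perm_uniq (permEl (perm_catCA [:: x] [:: y] _))).
  by rewrite cons_uniq => /andP[].
Qed.

Lemma no_short_chord x : x \in s -> ~~ adj G x (nx (nx x)).
Proof.
move=> xs; apply/negP => xz.
have [p [_ _ [_ _ zh ph] _ [up sp]]] := cycle_window xs.
apply: no_short; exists G, [:: x, nx (nx x), nx (nx (nx x)) & p].
by split=> //=; rewrite xz zh.
Qed.

(** With [x] before [y] and [z] after it, a missing edge [yt] would allow trading [xy], [zt] for
    [xz], [yt], and the cycle could skip [y]. *)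
Lemma nbrs_pass_back y t : y \in s -> adj G (nx y) t -> t != nx (nx y) ->
  t != y -> adj G y t.
Proof.
move=> ys zt th ty; apply: contraT => nyt.
pose x := prev s y; have xs : x \in s by rewrite mem_prev.
have yE : nx x = y by rewrite next_prev.
have [p [_ [xy xz yz] [exy eyz ezh ph] avoid [up sp]]] := cycle_window xs.
have nxz := no_short_chord xs; rewrite yE in xy xz yz exy eyz ezh ph avoid up sp nxz.
have nyt' : y != t by rewrite eq_sym.
have nzt := adjE_neq zt.
have [G' [dG' xz' _ keep]] := switch4 exy zt xz nyt' nxz nyt.
exfalso; apply: no_short; exists G', [:: x, nx y, nx (nx y) & p]; split=> //.
have yh : y != nx (nx y) by case/andP: avoid; rewrite !inE negb_or eq_sym => /andP[].
rewrite /= xz' keep //; last 2 first.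
- by edge_neq.
- by edge_neq.
apply: path_keep avoid ph => a b ab; rewrite !inE !negb_or.
by move=> /andP[ay az] /andP[by_ bz]; apply: keep => //; edge_neq.
Qed.

(** The cycle is induced. By induction on the distance from [t] to [b]: a chord at [b] passes back
    to the predecessor of [b], and eventually becomes a chord skipping one vertex. *)
Lemma no_chord t b : t \in s -> b \in s -> adj G b t -> b != nx t -> nx b = t.
Proof.
move=> ts bs; have [j] := cycle_iter_next ts bs.
elim: j b bs => [|j IH] b bs /=; first by move<-; rewrite adj_irrefl.
move=> bE bt bnx; apply/eqP; apply: contraT => nbt.
pose y := iter j nx t.
have ys : y \in s by rewrite /y; elim: (j) => //= i; rewrite mem_next.
have ty : t != y by apply: contraNneq bnx => e; rewrite -bE -/y -e.
have yt : adj G y t.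
  by apply: nbrs_pass_back ys _ _ ty; rewrite /y bE // eq_sym.
have [ynx|ynx] := eqVneq y (nx t).
  by case/negP: (no_short_chord ts); rewrite -ynx bE adj_sym.
have := IH y ys erefl yt ynx; rewrite bE => e.
by move: bt; rewrite e adj_irrefl.
Qed.

(** Adjacency to [t] passes back round the whole cycle; then [t] can replace the two consecutive
    vertices [b] and [nx b]. *)
Lemma no_edge_leaving b t : b \in s -> t \notin s -> ~~ adj G b t.
Proof.
move=> bs ts; apply/negP => bt.
have neq y : y \in s -> t != y by move=> ys; apply: contraNneq ts => ->.
have all_adj x : x \in s -> adj G x t.
  move=> xs; have [j] := cycle_iter_next xs bs.
  elim: j x xs => [|j IH] x xs; first by move=> /= ->.
  have ys : nx x \in s by rewrite mem_next.
  rewrite iterSr => /(IH _ ys) xt; apply: nbrs_pass_back xs xt _ (neq _ xs).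
  by apply: neq; rewrite mem_next.
have [p [sE _ [_ _ zh ph] _ [up sp]]] := cycle_window bs.
set z := nx (nx b) in sE zh ph up sp; set h := nx z in sE zh ph up sp.
apply: no_short; exists G, [:: t, z, h & p]; split=> //.
  move: up; rewrite /= => /andP[_ ->]; rewrite andbT.
  by apply: contra ts => tin; rewrite -sE !inE; move: tin; rewrite !inE => ->; rewrite !orbT.
have tz : adj G t z by rewrite adj_sym all_adj ?mem_next.
move: ph; rewrite rcons_path => /andP[ph _]; rewrite /= tz zh rcons_path ph /=.
apply: all_adj; rewrite -sE; have := mem_last h p.
by rewrite !inE => /orP[|] ->; rewrite ?orbT.
Qed.

(** The closed trail [x y u v y z] trades [xy], [uv], [yz] for [yu], [vy], [zx]: [y] leaves the
    cycle and subdivides the edge [uv]. *)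
Lemma no_off_cycle_edge u v : u \notin s -> v \notin s -> ~~ adj G u v.
Proof.
move=> u_s v_s; apply/negP => uv.
have [x xs] : exists x, x \in s.
  by case: (s) s4 => // x q *; exists x; rewrite mem_head.
have [p [sE [xy xz yz] [exy eyz ezh ph] avoid [up sp]]] := cycle_window xs.
have nxz := no_short_chord xs.
set y := nx x in sE xy xz yz exy eyz ezh ph avoid up sp nxz.
set z := nx y in sE xz yz eyz ezh ph avoid up sp nxz.
set h := nx z in sE ezh ph avoid up sp.
have ys : y \in s by rewrite mem_next.
have zs : z \in s by rewrite mem_next.
have hs : h \in s by rewrite mem_next.
have out w t : w \notin s -> t \in s -> w != t by move=> ws; apply: contraTneq => <-.
have [ux uy uz uh] := And4 (out _ _ u_s xs) (out _ _ u_s ys) (out _ _ u_s zs) (out _ _ u_s hs).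
have [vx vy vz vh] := And4 (out _ _ v_s xs) (out _ _ v_s ys) (out _ _ v_s zs) (out _ _ v_s hs).
have nuv := adjE_neq uv.
have yh : y != h by case/andP: avoid; rewrite !inE negb_or eq_sym => /andP[].
have [|||||G' [dG' [_ _ zx'] keep]] := @switch6 _ G x y u v y z.
- by [].
- split; last by rewrite adj_sym.
    exact: no_edge_leaving.
  by rewrite adj_sym no_edge_leaving.
- by split=> //; rewrite eq_sym.
- by split; edge_neq.
- by split; edge_neq.
apply: no_short; exists G', [:: x, z, h & p]; split=> //.
rewrite /= adj_sym zx' keep //; last 3 first.
- by edge_neq.
- by edge_neq.
- by edge_neq.
have avoid' : all (fun t => t \notin [:: y; u]) (h :: rcons p x).
  apply/allP => t tin; rewrite !inE negb_or; apply/andP; split.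
    by have := allP avoid t tin; rewrite !inE negb_or => /andP[].
  rewrite eq_sym; apply: out u_s _; rewrite -sE; move: tin.
  by rewrite !inE mem_rcons !inE => /or3P[] ->; rewrite ?orbT.
apply: path_keep avoid' ph => a b ab; rewrite !inE !negb_or.
by move=> /andP[ay az] /andP[by_ bz]; apply: keep => //; edge_neq.
Qed.

End Shorten.

(** Otherwise [G1] is an induced cycle plus isolated vertices, whereas the degree sum forces a
    vertex of degree at least 3. *)
Lemma potential_cycle_pred G k : 2 * #|V| < \sum_v degree G v -> 2 < k ->
  potential_cycle G k.+1 -> potential_cycle G k.
Proof.
move=> sum_gt k2 [G1 [s [d1 us cs sk]]]; apply: NNPP => no_k.
have s4 : 3 < size s by rewrite sk.
have no_short : ~ potential_cycle G1 (size s).-1.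
  rewrite sk => -[G2 [s2 [d2 us2 cs2 sk2]]]; apply: no_k; exists G2, s2; split=> //.
  by move=> v; rewrite d2 d1.
have [v dv] : exists v, 2 < degree G1 v.
  apply/existsP; apply: contraLR sum_gt; rewrite negb_exists -leqNgt => /forallP h.
  rewrite mulnC -sum_nat_const; apply: leq_sum => v _.
  by have := h v; rewrite d1 -leqNgt.
have [vs|vs] := boolP (v \in s).
  suff : degree G1 v <= 2 by rewrite leqNgt dv.
  apply: (@leq_trans #|[set next s v; prev s v]|); last first.
    by rewrite cards2; case: (_ != _).
  apply: subset_leq_card; apply/subsetP => t; rewrite !inE => vt.
  have ts : t \in s.
    apply: contraLR vt => ts; exact: (no_edge_leaving us cs s4 no_short vs ts).
  have [//|tn /=] := eqVneq t (next s v).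
  have tv : adj G1 t v by rewrite adj_sym.
  by rewrite -(no_chord us cs s4 no_short vs ts tv tn) prev_next.
have : 0 < degree G1 v by apply: leq_trans dv.
case/card_gt0P=> t; rewrite inE => vt; move: (vt); apply/negP.
have [ts|ts] := boolP (t \in s).
  by rewrite adj_sym; apply: (no_edge_leaving us cs s4 no_short).
exact: (no_off_cycle_edge us cs s4 no_short).
Qed.

End ShortCycles.

(** * The upper bound *)

Lemma mul_predD (a b : nat) : b * (a + b).-1 + b = b * (a + b).
Proof. by case: b => [|b]; rewrite ?mul0n // addnS /=; nia. Qed.

(** The count for [a < m], with [m = a + j] and cycle length [a + b]. *)
Lemma even_threshold_bound (a b j n : nat) : 0 < j -> 3 <= a + j ->
    a + b <= 2 * (a + j) + 1 -> 5 * (a + j) <= n + 2 ->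
  a * b + b * (a + b).-1 + (n - (a + b)) * (2 * a) <
    (a + j) * (2 * n - (a + j) - 1) + 4.
Proof.
move=> j0 m3 hb hn.
(* Truncated subtractions are replaced by named differences, and the needed products are supplied as
   facts, so that [lia] can treat monomials as atoms. *)
have [c cE] : exists c, n = a + b + c by exists (n - (a + b)); lia.
have [r rE] : exists r, 2 * n = r + (a + j) + 1 by exists (2 * n - (a + j) - 1); lia.
have -> : 2 * n - (a + j) - 1 = r by lia.
have -> : n - (a + b) = c by lia.
have bp := mul_predD a b.
have rm : (a + j) * (2 * n) = (a + j) * r + (a + j) * (a + j) + (a + j).
  by rewrite rE !mulnDr muln1.
have bB : b * b <= (a + 2 * j + 1) * (a + 2 * j) + b.
  have : b * b.-1 <= (a + 2 * j + 1) * (a + 2 * j) by apply: leq_mul; lia.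
  by clear; case: b => // b /=; nia.
have jn : j * (5 * (a + j)) <= j * (n + 2) by rewrite leq_mul2l hn orbT.
have aj : a * 1 <= a * j by rewrite leq_mul2l j0 orbT.
have j2 : 2 * j <= j * j + 1 by case: (j) j0 => // i _; nia.
have an : a * n = a * (a + b + c) by rewrite cE.
by clear rE cE hb hn m3; lia.
Qed.

(* With [b = a + 2 j + 1 - e], increasing [b] to its largest value increases
   the left-hand side by [e (b - a) + e (b + e - 2)]. *)
Lemma off_edge_threshold_bound (a b j n : nat) : 0 < j -> 3 <= a + j ->
    2 * a <= b -> a + b <= 2 * (a + j) + 1 -> 5 * (a + j) <= n + 2 ->
  a * a.+1 + b * (a + b).-1 + (n - (a + b)) * (2 * a).+1 <
    (a + j) * (2 * n - (a + j) - 1) + 4.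
Proof.
move=> j0 m3 h2 hb hn.
have [c cE] : exists c, n = a + b + c by exists (n - (a + b)); lia.
have [r rE] : exists r, 2 * n = r + (a + j) + 1 by exists (2 * n - (a + j) - 1); lia.
have [e eE] : exists e, a + 2 * j + 1 = b + e by exists (a + 2 * j + 1 - b); lia.
have [f fE] : exists f, b = 2 * a + f by exists (b - 2 * a); lia.
have [g gE] : exists g, a + 2 * j + 1 = 2 + g by exists (a + 2 * j + 1 - 2); lia.
have -> : 2 * n - (a + j) - 1 = r by lia.
have -> : n - (a + b) = c by lia.
have bp := mul_predD a b.
have rm : (a + j) * (2 * n) = (a + j) * r + (a + j) * (a + j) + (a + j).
  by rewrite rE !mulnDr muln1.
have [i jE] : exists i, j = i.+1 by exists j.-1; rewrite prednK.
subst j.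
(* The gap between the two sides grows in [n] with slope [2 j - 1 = 2 i + 1], so the bound on [n] is
   multiplied by [i]. *)
have jn : i * (5 * (a + i.+1)) <= i * (n + 2) by rewrite leq_mul2l hn orbT.
have an : a * n = a * (a + b + c) by rewrite cE.
have eg : e * (a + 2 * i.+1 + 1) = e * (2 + g) by rewrite gE.
have eb : e * b = e * (2 * a + f) by rewrite fE.
have ee : e * (a + 2 * i.+1 + 1) = e * (b + e) by rewrite eE.
have BB : (a + 2 * i.+1 + 1) * (a + 2 * i.+1 + 1) = (b + e) * (b + e) by rewrite eE.
have aB : a * (a + 2 * i.+1 + 1) = a * (b + e) by rewrite eE.
have ai : i * i <= (a + i) * i by rewrite leq_mul2r leq_addl orbT.
by clear rE hb; lia.
Qed.

Lemma cycle_length_arith (m n c a S : nat) : 3 <= m -> 5 * m - 2 <= n ->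
    m * (2 * n - m - 1) + 4 <= S -> c <= 2 * m + 1 -> 2 * a <= c ->
  (S <= a * (c - a) + (c - a) * c.-1 + (n - c) * (2 * a) /\
   (c = (2 * a).+1 -> S + a.-1 <=
     a.+1 * a.+1 + a * (2 * a) + (n - c) * (2 * a)))
  \/ (3 * a <= c /\
   S <= a * a.+1 + (c - a) * c.-1 + (n - c) * (2 * a).+1) -> False.
Proof.
move=> m3 hn hS hc ha.
have [am|am] := ltnP a m.
  have [j j0 mE] : exists2 j, 0 < j & m = a + j by exists (m - a); lia.
  have [b cE] : exists b, c = a + b by exists (c - a); lia.
  have hn' : 5 * m <= n + 2 by lia.
  subst m; subst c; rewrite addKn.
  case=> [[h _]|[h3 h]].
    have := even_threshold_bound j0 m3 hc hn'; move: (leq_trans hS h).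
    by rewrite leqNgt => /negP.
  have ab : 2 * a <= b by lia.
  have := off_edge_threshold_bound j0 m3 ab hc hn'; move: (leq_trans hS h).
  by rewrite leqNgt => /negP.
have {am} aE : a = m by lia.
subst a; case=> [[h1 h2]|[h _]]; last by lia.
(* For [c = 2 m + 1] the plain bound reaches the threshold; the sharpened odd bound falls 2 short of
   it. For [c = 2 m] the plain bound is 4 short. *)
have [cE|cE] : c = (2 * m).+1 \/ c = 2 * m by lia.
  by move: {h1 h2}(h2 cE); rewrite cE; nia.
by move: {h2} h1; rewrite cE; nia.
Qed.

(** * A realization with a cycle of length exactly [2 m + 2] *)

Section UpperBound.

Variables (V : finType) (m : nat) (G : sgraph V).
Hypotheses (hm : 3 <= m) (hn : 5 * m - 2 <= #|V|).
Hypothesis hS : m * (2 * #|V| - m - 1) + 4 <= \sum_v degree G v.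

Lemma degree_sum_gt : 2 * #|V| < \sum_v degree G v.
Proof.
apply: leq_trans hS; have : 3 * (2 * #|V| - m - 1) <= m * (2 * #|V| - m - 1).
  by rewrite leq_mul2r hm orbT.
by clear hS; lia.
Qed.

Lemma same_degrees_sum G' : same_degrees G G' ->
  \sum_v degree G' v = \sum_v degree G v.
Proof. by move=> d; apply: eq_bigr => v _; rewrite d. Qed.

Lemma longest_cycle_large G' s : same_degrees G G' -> longest_cycle G' s ->
  2 * m + 2 <= size s.
Proof.
move=> dG lc; rewrite leqNgt; apply/negP => small.
have cV : size s < #|V| by move: hm hn small; clear; lia.
have [a ha] := longest_cycle_degree_sum lc cV.
rewrite same_degrees_sum //; apply: cycle_length_arith hS _ ha => //.
by move: small; rewrite addn2 ltnS addn1.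
Qed.

(** Induction on [#|V| - k]: a short potential cycle is either extendable to a longer one or a
    longest cycle, and the latter contradicts the edge count. *)
Lemma potential_cycle_large k : 2 < k -> potential_cycle G k ->
  exists2 k', 2 * m + 2 <= k' & potential_cycle G k'.
Proof.
have [d] := ubnP (#|V| - k); elim: d k => // d IH k kd k2 [G1 [s [d1 us cs sk]]].
have [long|short] := leqP (2 * m + 2) k.
  by exists k => //; exists G1, s.
case: (classic (exists2 k', k < k' & potential_cycle G k')) => [[k' kk' pk']|no].
  have kV : k' <= #|V|.
    by case: pk' => G2 [s2 [_ us2 _ <-]]; rewrite -(card_uniqP us2) max_card.
  by apply: (IH k') pk'; [move: kk' kV kd; clear; lia | exact: ltn_trans kk'].
have lc : longest_cycle G1 s.
  split=> //; first by rewrite sk.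
  move=> G2 s2 d2 us2 cs2; rewrite leqNgt sk; apply/negP => lt.
  apply: no; exists (size s2) => //; exists G2, s2; split=> // v.
  by rewrite d2 d1.
by move: short; rewrite -sk ltnNge (longest_cycle_large d1 lc).
Qed.

Lemma potential_cycle_even : potential_cycle G (2 * m + 2).
Proof.
have gt := degree_sum_gt.
have [k0 k02 pk0] := potential_cycle_start gt.
have [k + pk] := potential_cycle_large k02 pk0.
elim: k pk => [_|k IH pk]; first by rewrite addn2.
rewrite leq_eqVlt => /predU1P[-> //|]; rewrite ltnS => le.
apply: IH (le); apply: potential_cycle_pred gt _ pk.
by apply: leq_trans le; move: hm; clear; lia.
Qed.

End UpperBound.

(** * From cyclic sequences to embedded cycle graphs *)

Lemma cycle_nth (T : eqType) (e : rel T) (x0 : T) (s : seq T) i :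
  cycle e s -> i < size s -> e (nth x0 s i) (nth x0 s (i.+1 %% size s)).
Proof.
case: s => // x p /= /(pathP x0) h lti.
have := h i; rewrite size_rcons => /(_ lti).
rewrite -rcons_cons nth_rcons /= lti nth_rcons.
move: lti; rewrite ltnS leq_eqVlt => /predU1P[->|lti].
  by rewrite ltnn eqxx modnn.
by rewrite lti modn_small.
Qed.

Lemma contains_cycle (V : finType) (G : sgraph V) (s : seq V) k :
  size s = k -> uniq s -> cycle (adj G) s ->
  contains_subgraph G (cycle_graph k).
Proof.
move=> <- us cs; case: s => [|x0 p] in us cs *.
  exists (fun i : 'I_(size [::]) => False_rect V (notF (ltn_ord i))).
  by split=> [[]|[]].
exists (fun i : 'I_(size (x0 :: p)) => nth x0 (x0 :: p) i); split.
  move=> i j e; apply/val_inj/eqP; rewrite -(nth_uniq x0 _ _ us) ?ltn_ord //.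
  exact/eqP.
move=> i j /andP[_ /orP[]] /eqP <-; last rewrite adj_sym.
  exact: cycle_nth.
exact: cycle_nth.
Qed.

Lemma sumn_realization n (S : n.-tuple nat) (G : sgraph 'I_n) :
  realization S G -> sumn S = \sum_v degree G v.
Proof.
by move=> r; rewrite sumnE big_tuple; apply: eq_bigr => i _; rewrite r.
Qed.

Lemma forces_even_cycle m n : 3 <= m -> 5 * m - 2 <= n ->
  forces_potentially (cycle_graph (2 * m + 2)) n (m * (2 * n - m - 1) + 4).
Proof.
move=> hm hn S [G rG]; rewrite (sumn_realization rG) => hS.
have [|||G' [s [d us cs sk]]] := @potential_cycle_even _ m G; rewrite ?card_ord //.
exists G'; split; first by move=> i; rewrite d rG.
exact: contains_cycle sk us cs.
Qed.

(** * The extremal graph *)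

Lemma card_ord_lt n k : k <= n -> #|[set j : 'I_n | j < k]| = k.
Proof.
move=> kn; rewrite -sum1dep_card -(big_ord_widen n (fun=> 1) kn).
by rewrite sum1_card card_ord.
Qed.

Lemma ordS_eq k (i : 'I_k) : ordS i = (if i.+1 == k then 0 else i.+1) :> nat.
Proof.
have [e|ne] := eqVneq i.+1 k; first by rewrite /= {1}e modnn.
by rewrite /= modn_small // ltn_neqAle ne ltn_ord.
Qed.

Lemma ordS_neq k (i : 'I_k) : 1 < k -> i != ordS i.
Proof.
by rewrite -val_eqE [val (ordS i)]ordS_eq; case: (eqVneq i.+1 k) => /=; lia.
Qed.

Lemma ordSS_neq k (i : 'I_k) : 2 < k -> i != ordS (ordS i).
Proof.
rewrite -val_eqE [val (ordS _)]ordS_eq ordS_eq.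
by have [e|ne] := eqVneq i.+1 k; [case: (eqVneq 1 k) | case: (eqVneq i.+2 k)] => /=; lia.
Qed.

Section Extremal.

Variables m n : nat.

(* [K_m] joined to the disjoint union of one edge and [n - m - 2] isolated
   vertices. *)
Definition extremal_adj : rel 'I_n := fun i j =>
  (i != j) && [|| i < m, j < m | (i < m.+2) && (j < m.+2)].

Lemma extremal_sym : symmetric extremal_adj.
Proof.
move=> i j; rewrite /extremal_adj eq_sym orbCA; congr (_ && (_ || (_ || _))).
exact: andbC.
Qed.

Lemma extremal_irrefl : irreflexive extremal_adj.
Proof. by move=> i; rewrite /extremal_adj eqxx. Qed.

Definition extremal : sgraph 'I_n := SGraph extremal_sym extremal_irrefl.

Hypothesis mn : m.+2 <= n.

(** The values are [n - 1] for a hub, [m + 1] for an end of the extra edge, and [m] otherwise. *)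
Lemma extremal_degree i :
  degree extremal i = m + (i < m.+2) + (i < m) * (n - m.+2).
Proof.
rewrite /degree; have [im|mi] := ltnP i m.
  have -> : [set j | extremal_adj i j] = [set~ i].
    by apply/setP => j; rewrite !inE /extremal_adj im andbT eq_sym.
  rewrite cardsC1 card_ord (leq_trans im) ?leqW //.
  by move: mn; clear; lia.
have [im|im] := ltnP i m.+2.
  have -> : [set j | extremal_adj i j] = [set j : 'I_n | j < m.+2] :\ i.
    apply/setP => j; rewrite !inE /extremal_adj im ltnNge mi /= eq_sym.
    by case: ltnP => // /leqW/leqW; rewrite ltnS => ->.
  have := cardsD1 i [set j : 'I_n | j < m.+2].
  by rewrite card_ord_lt // inE im add1n => -[<-]; rewrite mul0n addn0 addn1.
have -> : [set j | extremal_adj i j] = [set j : 'I_n | j < m].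
  apply/setP => j; rewrite !inE /extremal_adj (ltnNge i) mi (ltnNge i) im /= orbF.
  by case: eqP => // <-; rewrite ltnNge mi.
by rewrite card_ord_lt ?mul0n ?addn0 //; move: mn; clear; lia.
Qed.

Lemma extremal_degree_sum :
  \sum_i degree extremal i = m * (2 * n - m - 1) + 2.
Proof.
under eq_bigr do rewrite extremal_degree.
have count k : k <= n -> \sum_(i < n) (i < k) = k.
  by move=> kn; rewrite -[RHS](card_ord_lt kn) -sum1dep_card [RHS]big_mkcond.
rewrite !big_split /= -big_distrl /= !count ?sum_nat_const ?card_ord //; last first.
  by move: mn; clear; lia.
have [d ->] : exists d, n = m.+2 + d by exists (n - m.+2); rewrite subnKC.
rewrite addKn (_ : 2 * _ - m - 1 = m + 3 + 2 * d); last by clear; lia.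
by clear; lia.
Qed.

Variable G : sgraph 'I_n.
Hypothesis dG : forall i, degree G i = degree extremal i.

Lemma hub_adj (i j : 'I_n) : i < m -> i != j -> adj G i j.
Proof.
move=> im ij; have : [set j | adj G i j] == [set~ i].
  rewrite eqEcard cardsC1 card_ord; apply/andP; split.
    by apply/subsetP => k; rewrite !inE eq_sym; apply: adjE_neq.
  have := extremal_degree i; rewrite -dG /degree => ->.
  by rewrite im (leq_trans im) ?leqW //; move: mn; clear; lia.
by move/eqP/setP/(_ j); rewrite !inE eq_sym ij.
Qed.

(** A vertex of degree [m] is adjacent to all [m] hubs, which exhausts its neighbours. *)
Lemma non_hub_edge (i j : 'I_n) : m <= i -> m <= j -> adj G i j -> i < m.+2.
Proof.
move=> mi mj; apply: contraTT; rewrite -leqNgt => mi2.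
have : [set k : 'I_n | k < m] == [set k | adj G i k].
  rewrite eqEcard card_ord_lt; last by move: mn; clear; lia.
  apply/andP; split.
    apply/subsetP => k; rewrite !inE adj_sym => km; apply: hub_adj => //.
    by apply: contraTneq km => ->; rewrite -leqNgt.
  have := extremal_degree i; rewrite -dG /degree => ->.
  by rewrite [i < m.+2]ltnNge mi2 [i < m]ltnNge mi mul0n !addn0.
by move/eqP/setP/(_ j); rewrite !inE ltnNge mj => <-.
Qed.

(* At most [2m] of the [2m+2] cycle edges meet a hub; the other two would both
   have to be the single edge between non-hubs. *)
Lemma extremal_no_cycle : 0 < m ->
  ~ contains_subgraph G (cycle_graph (2 * m + 2)).
Proof.
move=> m0 [f [injf adjf]]; set K := 2 * m + 2 in f injf adjf.
have K3 : 2 < K by rewrite /K; lia.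
have [S1 S2] : (forall k : 'I_K, k != ordS k) /\ (forall k : 'I_K, k != ordS (ordS k)).
  by split=> k; [exact: ordS_neq (ltnW _) | exact: ordSS_neq].
have fS k : adj G (f k) (f (ordS k)).
  by apply: adjf; rewrite /= /cycle_adj S1 eqxx.
(* [Z] holds the positions of hubs, [B] those whose outgoing cycle edge avoids hubs, [W] those of
   the ends of the extra edge. *)
pose Z := [set k : 'I_K | f k < m].
pose B := [set k : 'I_K | (k \notin Z) && (ordS k \notin Z)].
pose W := [set k : 'I_K | (m <= f k) && (f k < m.+2)].
have Z_le : #|Z| <= m.
  have mn' : m <= n by move: mn; clear; lia.
  rewrite -(card_imset _ injf) -[X in _ <= X](card_ord_lt mn').
  by apply: subset_leq_card; apply/subsetP => _ /imsetP[k + ->]; rewrite !inE.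
have W_le : #|W| <= 2.
  rewrite -(card_imset _ injf).
  apply: (@leq_trans #|[set j : 'I_n | j < m.+2] :\: [set j : 'I_n | j < m]|).
    apply: subset_leq_card; apply/subsetP => _ /imsetP[k + ->].
    by rewrite !inE -leqNgt.
  rewrite cardsDS; last by apply/subsetP => j; rewrite !inE => jm; rewrite !leqW.
  by rewrite !card_ord_lt //; move: mn; clear; lia.
have B_ge : 1 < #|B|.
  have BC : ~: B = Z :|: (@ordS K) @^-1: Z.
    by apply/setP => k; rewrite !inE negb_and !negbK.
  have := cardsC B; rewrite BC card_ord.
  have := (leq_card_setU Z ((@ordS K) @^-1: Z)).1.
  rewrite card_preimset; last exact: can_inj (@ordSK K).
  by move: Z_le; rewrite /K; clear; lia.
have BW k : k \in B -> k \in W /\ ordS k \in W.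
  rewrite !inE -!leqNgt => /andP[mk mk']; rewrite mk mk' /=; split.
    exact: non_hub_edge (fS k).
  by apply: (non_hub_edge mk' mk); rewrite adj_sym.
(* Since [#|W| <= 2 <= #|B|], the inclusion is an equality, so [B] is closed under [ordS] and
   contains three distinct consecutive positions. *)
have BE : B = W.
  apply/eqP; rewrite eqEcard (leq_trans W_le B_ge) andbT.
  by apply/subsetP => k /BW[].
have [k kB] : exists k, k \in B by apply/card_gt0P; apply: ltnW.
have [k1 k2] := BW _ kB; have [_ k3] : ordS k \in W /\ ordS (ordS k) \in W.
  by apply: BW; rewrite BE.
have : #|[set k; ordS k; ordS (ordS k)]| <= #|W|.
  by apply: subset_leq_card; rewrite !subUset !sub1set k1 k2 k3.
rewrite -setUA cardsU1 cards2 !inE (negbTE (S1 k)) (negbTE (S2 k)) S1 /=.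
by rewrite leqNgt ltnS W_le.
Qed.

End Extremal.

(** * Sharpness and the exact value *)

Lemma not_forces_even_cycle m n : 0 < m -> m.+2 <= n ->
  exists2 S : n.-tuple nat, graphical S /\ sumn S = m * (2 * n - m - 1) + 2 &
    ~ potentially_graphical (cycle_graph (2 * m + 2)) S.
Proof.
move=> m0 mn; pose S := [tuple degree (extremal m n) i | i < n].
have rS : realization S (extremal m n) by move=> i; rewrite tnth_mktuple.
exists S; first split; first by exists (extremal m n).
  by rewrite (sumn_realization rS) extremal_degree_sum.
case=> G [rG]; apply: extremal_no_cycle => // i.
by rewrite rG tnth_mktuple.
Qed.

Theorem theorem5 (m n : nat) (hm : 3 <= m) (hn : 5 * m - 2 <= n) :
  is_sigma (cycle_graph (2 * m + 2)) n (m * (2 * n - m - 1) + 4).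
Proof.
(* [m] and [m + 1] have opposite parity, so the product is even; an even [l] above the extremal sum
   then exceeds it by at least 2. *)
have ev : ~~ odd (m * (2 * n - m - 1)).
  rewrite -subnDA oddM oddB; last by lia.
  by rewrite oddD mul2n odd_double; case: (odd m).
split.
- by rewrite oddD (negbTE ev).
- exact: forces_even_cycle.
move=> l even_l force; have m0 : 0 < m by lia.
have mn : m.+2 <= n by lia.
have [S [gS sS] nS] := not_forces_even_cycle m0 mn.
have : sumn S < l.
  by rewrite ltnNge; apply/negP => le; apply: nS; apply: force.
by rewrite sS; move: ev even_l; move: (m * _) => x; clear; lia.
Qed.
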